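(* Let $q\in K^*$ be not a root of unity and put $z=a_{11}a_{22}^{-1}\in UT_q(2)$. Then $$\mathrm{Der}(UT_q(2))=\mathrm{IDer}(UT_q(2))\oplus K[z^{\pm1}]D_{11}\oplus K[z^{\pm1}]D_{12}\oplus K[z^{\pm1}]D_{22}.$$ In particular, $\mathrm{HH}^1(UT_q(2))$ is a free module of rank $3$ over $Z(UT_q(2))=K[z^{\pm1}]$.
   Context: $K$ is a field of characteristic different from $2$. For an algebra $A$: $Z(A)$ is the center, $\mathrm{Der}(A)$ the Lie algebra of $K$-linear derivations, $\mathrm{IDer}(A)$ the ideal of inner derivations, and $\mathrm{HH}^1(A)=\mathrm{Der}(A)/\mathrm{IDer}(A)$ the first Hochschild cohomology (a $Z(A)$-module). $T_q(2)$ is the unital associative $K$-algebra generated by $a_{11},a_{12},a_{22}$ with relations $a_{22}a_{12}=qa_{12}a_{22}$, $a_{11}a_{12}=qa_{12}a_{11}$, $a_{11}a_{22}=a_{22}a_{11}$. $UT_q(2)$ is the localization of $T_q(2)$ at the multiplicative set generated by $a_{11}$ and $a_{22}$. For $(s,t)\in\{(1,1),(1,2),(2,2)\}$, $D_{st}$ denotes the derivation of $UT_q(2)$ (the unique extension of the corresponding derivation of $T_q(2)$) with $D_{st}(a_{st})=a_{st}$ and $D_{st}(a_{ij})=0$ for $(i,j)\ne(s,t)$. The element $z$ is central in $UT_q(2)$ and $K[z^{\pm1}]$ is the Laurent polynomial subalgebra it generates. *)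

(* Defs.v *)
From HB Require Import structures.
From mathcomp Require Import all_boot all_order all_algebra ring_quotient.
From mathcomp Require Import boolp classical_sets functions.
From mathcomp Require Export monalg.

Set Implicit Arguments.
Unset Strict Implicit.
Unset Printing Implicit Defensive.

Import GRing.Theory.
Import Quotient.

Local Open Scope ring_scope.
Local Open Scope quotient_scope.
Local Open Scope classical_set_scope.

Section Center.
Variable A : nzRingType.

Definition central : {pred A} := fun c => `[< forall x : A, c * x = x * c >].

Lemma centralP (c : A) : reflect (forall x, c * x = x * c) (c \in central).
Proof. exact: asboolP. Qed.

Fact central_subring : subring_closed central.
Proof.
split=> [|c d /centralP cP /centralP dP|c d /centralP cP /centralP dP].
- by apply/centralP => x; rewrite mul1r mulr1.
- by apply/centralP => x; rewrite mulrBl mulrBr cP dP.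
- by apply/centralP => x; rewrite -mulrA dP !mulrA cP.
Qed.
HB.instance Definition _ := GRing.isSubringClosed.Build A central
  central_subring.

Record center := Center { center_val :> A; _ : center_val \in central }.
HB.instance Definition _ := [isSub for center_val].
HB.instance Definition _ := [Choice of center by <:].
HB.instance Definition _ := [SubChoice_isSubNzRing of center by <:].

Lemma centerC (c : center) (x : A) : val c * x = x * val c.
Proof. by have /centralP := valP c; apply. Qed.

Fact center_mulC : commutative (@GRing.mul center).
Proof. by move=> c d; apply: val_inj; rewrite !rmorphM /= centerC. Qed.
HB.instance Definition _ := GRing.PzRing_hasCommutativeMul.Build center
  center_mulC.

End Center.

Section Derivations.
Variables (K : fieldType) (A : algType K).

Definition derivation : {pred A -> A} := fun D =>
  `[< linear D /\ forall x y, D (x * y) = D x * y + x * D y >].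

Lemma derivationP (D : A -> A) :
  reflect (linear D /\ forall x y, D (x * y) = D x * y + x * D y)
          (D \in derivation).
Proof. exact: asboolP. Qed.

Fact derivation_zmod : zmod_closed derivation.
Proof.
split=> [|D E /derivationP[Dlin DM] /derivationP[Elin EM]].
  apply/derivationP; split=> [k x y|x y] /=.
    by rewrite scaler0 addr0.
  by rewrite mul0r mulr0 addr0.
apply/derivationP; split=> [k x y|x y] /=; rewrite !fctE.
  by rewrite Dlin Elin scalerBr opprD addrACA.
by rewrite DM EM mulrBl mulrBr opprD addrACA.
Qed.
HB.instance Definition _ := GRing.isZmodClosed.Build (A -> A) derivation
  derivation_zmod.

Record Der := MkDer { der_fun :> A -> A; _ : der_fun \in derivation }.
HB.instance Definition _ := [isSub for der_fun].
HB.instance Definition _ := [Choice of Der by <:].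
HB.instance Definition _ := [SubChoice_isSubZmodule of Der by <:].

Fact Der_scale_subproof (c : center A) (D : Der) :
  (fun x => val c * D x) \in derivation.
Proof.
have /derivationP[Dlin DM] := valP D; rewrite /= in Dlin DM.
apply/derivationP; split=> [k x y|x y].
  by rewrite Dlin mulrDr scalerAr.
by rewrite DM mulrDr !mulrA (centerC c x).
Qed.
Definition Der_scale c D := MkDer (Der_scale_subproof c D).

Fact Der_scaleA c d D : Der_scale c (Der_scale d D) = Der_scale (c * d) D.
Proof. by apply: val_inj; apply/funext => x /=; rewrite mulrA. Qed.
Fact Der_scale1 : left_id 1 Der_scale.
Proof. by move=> D; apply: val_inj; apply/funext => x /=; rewrite mul1r. Qed.
Fact Der_scaleDr : right_distributive Der_scale +%R.
Proof.
by move=> c D E; apply: val_inj; apply/funext => x /=; rewrite !fctE mulrDr.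
Qed.
Fact Der_scaleDl D : {morph Der_scale^~ D : c d / c + d}.
Proof.
by move=> c d; apply: val_inj; apply/funext => x /=; rewrite !fctE mulrDl.
Qed.
HB.instance Definition _ := GRing.Zmodule_isLmodule.Build (center A) Der
  Der_scaleA Der_scale1 Der_scaleDr Der_scaleDl.

Definition IDer : {pred Der} := fun D =>
  `[< exists a : A, forall x, D x = a * x - x * a >].

Lemma IDerP (D : Der) :
  reflect (exists a : A, forall x, D x = a * x - x * a) (D \in IDer).
Proof. exact: asboolP. Qed.

Fact IDer_submod : subsemimod_closed IDer.
Proof.
split; first split.
- by apply/IDerP; exists 0 => x; rewrite mul0r mulr0 subrr.
- move=> D E /IDerP[a aP] /IDerP[b bP]; apply/IDerP; exists (a + b) => x.
  by rewrite /= fctE aP bP mulrDl mulrDr opprD addrACA.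
- move=> c D /IDerP[a aP]; apply/IDerP; exists (val c * a) => x.
  by rewrite /= aP mulrBr !mulrA (centerC c x).
Qed.
HB.instance Definition _ := GRing.isSubmodClosed.Build (center A) Der IDer
  IDer_submod.

Definition HH1 := {quot (IDer : {pred Der})}.
HB.instance Definition _ := Choice.on HH1.
HB.instance Definition _ := GRing.Zmodule.on HH1.

Definition HH1_pi (D : Der) : HH1 := \pi_{quot (IDer : {pred Der})} D.
Definition HH1_scale (c : center A) (h : HH1) : HH1 :=
  HH1_pi (c *: repr (h : {quot (IDer : {pred Der})})).

Lemma HH1_piP (D E : Der) : HH1_pi D = HH1_pi E <-> D - E \in IDer.
Proof. by rewrite idealrBE; split=> [/eqP|/eqP]. Qed.

Lemma HH1_reprK (h : HH1) :
  HH1_pi (repr (h : {quot (IDer : {pred Der})})) = h.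
Proof. exact: reprK. Qed.

Lemma HH1_piD : {morph HH1_pi : D E / D + E}.
Proof. by move=> D E; exact: raddfD. Qed.

Lemma HH1_piZ c D : HH1_pi (c *: D) = HH1_scale c (HH1_pi D).
Proof.
apply/HH1_piP; rewrite -scalerBr rpredZ //; apply/HH1_piP.
by rewrite HH1_reprK.
Qed.

Fact HH1_scaleA c d h : HH1_scale c (HH1_scale d h) = HH1_scale (c * d) h.
Proof. by rewrite -[h]HH1_reprK -!HH1_piZ scalerA. Qed.
Fact HH1_scale1 : left_id 1 HH1_scale.
Proof. by move=> h; rewrite -[h]HH1_reprK -!HH1_piZ scale1r. Qed.
Fact HH1_scaleDr : right_distributive HH1_scale +%R.
Proof.
move=> c g h; rewrite -[g]HH1_reprK -[h]HH1_reprK.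
by rewrite -HH1_piD -!HH1_piZ scalerDr HH1_piD.
Qed.
Fact HH1_scaleDl h : {morph HH1_scale^~ h : c d / c + d}.
Proof.
move=> c d; rewrite -[h]HH1_reprK -!HH1_piZ.
by rewrite scalerDl HH1_piD.
Qed.
HB.instance Definition _ := GRing.Zmodule_isLmodule.Build (center A) HH1
  HH1_scaleA HH1_scale1 HH1_scaleDr HH1_scaleDl.

End Derivations.

Definition free_of_rank (R : nzRingType) (n : nat) (V : lmodType R) : Prop :=
  exists f : {linear 'rV[R]_n -> V}, bijective f.

Definition internal_direct_sum (V : zmodType) (n : nat)
    (W : 'I_n -> set V) : Prop :=
  (forall v, exists2 w : 'I_n -> V, (forall i, W i (w i)) & v = \sum_i w i) /\
  (forall w w' : 'I_n -> V, (forall i, W i (w i)) -> (forall i, W i (w' i)) ->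
     \sum_i w i = \sum_i w' i -> forall i, w i = w' i).

Definition two_sided_ideal (A : nzRingType) (I : set A) : Prop :=
  [/\ I 0, forall x y, I x -> I y -> I (x - y)
    & forall a x b, I x -> I (a * x * b)].

Definition mult_set (A : nzRingType) (S : set A) : Prop :=
  S 1 /\ forall x y, S x -> S y -> S (x * y).

(* The free algebra on n generators, as the monoid algebra of the free monoid
   on 'I_n. *)
Notation free_alg K n := {malg K[{fmonom 'I_n}]}.

Definition free_gen (K : fieldType) (n : nat) (i : 'I_n) : free_alg K n :=
  << fmu i >>.

Definition is_presented_by (K : fieldType) (n : nat) (rel : set (free_alg K n))
    (T : algType K) (a : 'I_n -> T) : Prop :=
  exists phi : {lrmorphism free_alg K n -> T},
    [/\ forall i, phi (free_gen K i) = a i,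
        forall t, exists f, phi f = t
      & forall f, phi f = 0 <-> smallest (@two_sided_ideal _) rel f].

(* The generators 0, 1, 2 are a11, a12, a22. *)
Definition Tq2_relations (K : fieldType) (q : K) : set (free_alg K 3) :=
  let a11 := free_gen K (inord 0 : 'I_3) in
  let a12 := free_gen K (inord 1 : 'I_3) in
  let a22 := free_gen K (inord 2 : 'I_3) in
  [set a22 * a12 - q *: (a12 * a22);
       a11 * a12 - q *: (a12 * a11);
       a11 * a22 - a22 * a11].

Definition is_Tq2 (K : fieldType) (q : K) (T : algType K) (a11 a12 a22 : T) :=
  is_presented_by (Tq2_relations q) (tnth [tuple a11; a12; a22]).

(* U is the ring of right fractions of T with denominators in S; when it
   exists it is unique up to a unique isomorphism over T. *)
Definition is_localization (K : fieldType) (T : algType K) (S : set T)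
    (U : unitAlgType K) (iota : {lrmorphism T -> U}) : Prop :=
  [/\ forall s, S s -> iota s \is a GRing.unit,
      forall u, exists t s, S s /\ u = iota t / iota s
    & forall t, iota t = 0 <-> exists2 s, S s & t * s = 0].

Definition is_UTq2 (K : fieldType) (T : algType K) (a11 a22 : T)
    (U : unitAlgType K) (iota : {lrmorphism T -> U}) : Prop :=
  is_localization (smallest (@mult_set T) [set a11; a22]) iota.

Definition laurent (K : fieldType) (U : unitAlgType K) (z : U) : set U :=
  [set u | exists (r : seq int) (c : int -> K),
     u = \sum_(i <- r) c i *: z ^ i].

(* The subalgebra K[z^{+-1}] is a Laurent polynomial ring in z. *)
Definition laurent_free (K : fieldType) (U : unitAlgType K) (z : U) : Prop :=
  forall (r : seq int) (c : int -> K), uniq r ->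
    \sum_(i <- r) c i *: z ^ i = 0 -> forall i, i \in r -> c i = 0.

(* The subspace K[z^{+-1}] D of Der(U). *)
Definition laurent_mul (K : fieldType) (U : unitAlgType K) (z : U)
    (D : Der U) : set (Der U) :=
  [set E | exists2 f, laurent z f & forall x, E x = f * D x].

(* Main.v *)
(** Write x = a11, y = a12 and z = a11 a22^-1. The monomials y^j x^a z^b, with
    j natural and a, b integers, form a basis of UT_q(2), where x y = q y x and
    z is central. As q is not a root of unity, commutators with x and with y
    are diagonal in this basis up to a shift, with weights 1 - q^j and q^a - 1
    that vanish only for j = 0 and a = 0; hence the center is K[z^{+-1}]. A
    derivation D maps z into the center, so subtracting (D z / z) D11 makes it
    kill z. An inner derivation then brings D x to the form c x with c free of
    y. Applying D to x y = q y x and comparing the degrees in y shows that c is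
    central and that D y = y v with v free of y; a second inner derivation
    makes v central too, and c (D11 + D22) + v D12 is all that remains. *)
From HB Require Import structures.
Require Import Defs.
From mathcomp Require Import all_boot all_order all_algebra.
From mathcomp Require Import boolp classical_sets functions.
From mathcomp Require Import ring zify.

Set Implicit Arguments.
Unset Strict Implicit.
Unset Printing Implicit Defensive.

Import GRing.Theory.

Local Open Scope ring_scope.
Local Open Scope classical_set_scope.

Fact lincomb0 (R : nzRingType) (V : lmodType R) (k : R) (u v : V) :
  u = 0 -> v = 0 -> k *: u + v = 0.
Proof. by move=> -> ->; rewrite scaler0 addr0. Qed.

(** * Linear induction and words in the free algebra *)

Section FreeAlgebra.
Variable K : fieldType.

Lemma malg_span (M : choiceType) (P : {malg K[M]} -> Prop) :
  P 0 -> (forall c f g, P f -> P g -> P (c *: f + g)) ->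
  (forall m, P << m >>) -> forall f, P f.
Proof.
move=> P0 PD PU f; rewrite [f]monalgE.
elim/big_rec: _ => // m g _ Pg.
have -> : << f@_m *g m >> = f@_m *: << m >> :> {malg K[M]}.
  by apply/malgP => k; rewrite mcoeffZ !mcoeffU mulr_natr.
exact: PD.
Qed.

Lemma malg_scalerAr (M : monomType) (c : K) (f g : {malg K[M]}) :
  f * (c *: g) = c *: (f * g).
Proof.
apply/malgP => k; rewrite mcoeffZ (@mcoeffMlw _ _ (msupp f) (msupp g)) ?msuppZ_le //.
rewrite mcoeffMl mulr_sumr.
apply: eq_bigr => k1 _; rewrite mulr_sumr; apply: eq_bigr => k2 _.
by rewrite mcoeffZ mulrCA mulrnAr.
Qed.

Variable n : nat.

Definition word (v : seq 'I_n) : free_alg K n := << FMonom v >>.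

Lemma free_alg_span (P : free_alg K n -> Prop) :
  P 0 -> (forall c f g, P f -> P g -> P (c *: f + g)) ->
  (forall v, P (word v)) -> forall f, P f.
Proof.
move=> P0 PD PU f; apply: malg_span => // m.
by rewrite -[m]fmK; apply: PU.
Qed.

Lemma word_cat u v : word (u ++ v) = word u * word v.
Proof.
rewrite malgM_def fgmulUU mulr1; congr << _ >>; exact/esym/fmmulE.
Qed.

Lemma word1 i : word [:: i] = free_gen K i.
Proof. by rewrite /word /free_gen fmuE. Qed.

Lemma word_nil : word [::] = 1.
Proof. by rewrite /word -fmoneE. Qed.

End FreeAlgebra.

(** * Normal ordering of words modulo the quantum relations *)

Notation i11 := (inord 0 : 'I_3).
Notation i12 := (inord 1 : 'I_3).
Notation i22 := (inord 2 : 'I_3).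

Fact gen_eqE : ((i11 == i12) = false) * ((i12 == i11) = false) *
  ((i11 == i22) = false) * ((i22 == i11) = false) *
  ((i12 == i22) = false) * ((i22 == i12) = false).
Proof. by rewrite -!val_eqE /= !inordK. Qed.

Fact gen_case (i : 'I_3) : i = i11 \/ i = i12 \/ i = i22.
Proof.
by case: i => [[|[|[|//]]] lt_i]; [left|right; left|right; right];
  apply/val_inj; rewrite /= inordK.
Qed.

Section NormalOrdering.
Variables (K : fieldType) (q : K) (V : algType K).
Implicit Types (v : seq 'I_3) (h : nat -> nat -> nat -> V).

(** Only an [i12] to the right of an [i11] or [i22] counts: these are the swaps that cost a factor
    q, whereas [i11] and [i22] commute. *)
Fixpoint inversions v : nat :=
  if v is i :: v' then
    ((if i == i12 then 0 else count_mem i12 v') + inversions v')%N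
  else 0%N.

Lemma inversions_cat u v : inversions (u ++ v) = (inversions u + inversions v
  + (count_mem i11 u + count_mem i22 u) * count_mem i12 v)%N.
Proof.
elim: u => [|i u IH] /=; first by rewrite mul0n addn0.
rewrite IH count_cat.
by have [->|[->|->]] := gen_case i; rewrite ?eqxx ?gen_eqE /=; lia.
Qed.

(* Reordering a word with all letters a12 in front costs the factor
   q^inversions, so modulo the relations a word is determined by its letter
   counts. Keeping [h] arbitrary makes the common kernel of these functionals
   a two-sided ideal, without constructing T_q(2). *)
Definition normal_form h : free_alg K 3 -> V :=
  mmap (in_alg V) (fun v : {fmonom 'I_3} => q ^+ inversions v *:
    h (count_mem i11 v) (count_mem i12 v) (count_mem i22 v)).

Lemma normal_form_word h v : normal_form h (word K v) =
  q ^+ inversions v *: h (count_mem i11 v) (count_mem i12 v) (count_mem i22 v).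
Proof. by rewrite /normal_form mmapU /= scale1r mul1r. Qed.

Fact normal_form_is_linear h : linear (normal_form h).
Proof.
move=> c f g; rewrite /normal_form mmapD; congr (_ + _).
rewrite (mmapEw (msuppZ_le _ _)) mmapE scaler_sumr.
by apply: eq_bigr => m _; rewrite mcoeffZ /= -scalerA -scalerAl.
Qed.

HB.instance Definition _ h := GRing.isLinear.Build K (free_alg K 3) V _
  (normal_form h) (normal_form_is_linear h).

(** Multiplying by words on both sides only changes [h], so the condition that [normal_form h f]
    vanishes for all [h] is stable under it. The exponent collects the inversions other than those
    inside the words of [f]. *)
Lemma normal_form_sandwich h u v f :
  normal_form h (word K u * f * word K v) =
  normal_form (fun a b c => q ^+ (inversions u + inversions v
    + (count_mem i11 u + count_mem i22 u) * (b + count_mem i12 v)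
    + (a + c) * count_mem i12 v) *:
      h (count_mem i11 u + a + count_mem i11 v)%N
        (count_mem i12 u + b + count_mem i12 v)%N
        (count_mem i22 u + c + count_mem i22 v)%N) f.
Proof.
elim/free_alg_span: f => [|k f g IHf IHg|w].
- by rewrite mulr0 mul0r !linear0.
- rewrite mulrDr mulrDl malg_scalerAr -scalerAl.
  by rewrite [LHS]normal_form_is_linear [RHS]normal_form_is_linear -IHf -IHg.
rewrite -!word_cat !normal_form_word !count_cat scalerA -exprD.
by rewrite !inversions_cat !count_cat; congr (_ ^+ _ *: _); lia.
Qed.

Lemma normal_form_ideal : two_sided_ideal
  [set f | forall h, normal_form h f = 0].
Proof.
split=> [h|f g f0 g0 h|a f b f0 h] /=; first exact: linear0.
- by rewrite linearB /= f0 g0 subrr.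
elim/free_alg_span: a => [|k c d IHc IHd|u].
- by rewrite !mul0r linear0.
- rewrite 2!mulrDl -2!scalerAl normal_form_is_linear.
  exact: lincomb0 IHc IHd.
elim/free_alg_span: b => [|k c d IHc IHd|v].
- by rewrite mulr0 linear0.
- rewrite mulrDr malg_scalerAr normal_form_is_linear.
  exact: lincomb0 IHc IHd.
by rewrite normal_form_sandwich f0.
Qed.

Lemma normal_form_gen2 h i j : normal_form h (free_gen K i * free_gen K j) =
  q ^+ inversions [:: i; j] *: h (count_mem i11 [:: i; j])
    (count_mem i12 [:: i; j]) (count_mem i22 [:: i; j]).
Proof. by rewrite -2!word1 -(word_cat K [:: i]) normal_form_word. Qed.

Lemma normal_form_relations f h :
  smallest (@two_sided_ideal _) (Tq2_relations q) f -> normal_form h f = 0.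
Proof.
move=> If; move: f If h.
pose word2 h i j := q ^+ inversions [:: i; j] *: h (count_mem i11 [:: i; j])
  (count_mem i12 [:: i; j]) (count_mem i22 [:: i; j]).
have relE h i j c : word2 h i j = c *: word2 h j i ->
    normal_form h (free_gen K i * free_gen K j
      - c *: (free_gen K j * free_gen K i)) = 0.
  move=> E; rewrite linearB linearZ; apply/eqP; rewrite subr_eq0; apply/eqP.
  apply: etrans (normal_form_gen2 h i j) _; apply: etrans E _.
  by congr (_ *: _); exact/esym/normal_form_gen2.
apply: (smallest_sub normal_form_ideal) => f /= [[|]|] -> h;
  (* The commutation of a11 and a22 is brought to the shape of the other relations with c = 1. *)
  last rewrite -[X in _ - X](scale1r (_ * _));
  by apply: relE; rewrite /word2 /= ?eqxx ?gen_eqE /= ?addn0 ?expr0 ?expr1 ?scale1r.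
Qed.

End NormalOrdering.

Lemma inversions0 (v : seq 'I_3) : count_mem i12 v = 0%N -> inversions v = 0%N.
Proof.
elim: v => //= i v IH; case: eqP => //= _.
by rewrite add0n => v0; rewrite v0 IH.
Qed.

Lemma inversions_sorted j (v : seq 'I_3) : count_mem i12 v = 0%N ->
  inversions (nseq j i12 ++ v) = 0%N.
Proof.
move=> v0; rewrite inversions_cat v0 muln0 (inversions0 v0) !addn0.
by elim: j => //= j ->; rewrite eqxx.
Qed.

(** * Ordered monomials and the interface of a quantum basis *)

Definition exponent : Type := nat * int * int.

Section QuantumBasis.
Variables (K : fieldType) (U : unitAlgType K) (x y z : U).

(** Only y keeps natural exponents, since a12 is not inverted in the localization. *)
Definition qmon (m : exponent) : U := y ^+ m.1.1 * x ^ m.1.2 * z ^ m.2.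

Definition combination (e : exponent -> U) (s : seq (K * exponent)) : U :=
  \sum_(p <- s) p.1 *: e p.2.

(** The computation of the derivations rests on this interface alone. [qb_free] expresses
    independence by arbitrary assignments [e]: this allows repeated exponents in [s] and yields
    linear extension from the monomials. *)
Record quantum_basis (q : K) : Prop := QuantumBasis {
  qb_unitx : x \is a GRing.unit;
  qb_unitz : z \is a GRing.unit;
  qb_xy : x * y = q *: (y * x);
  qb_zx : z * x = x * z;
  qb_zy : z * y = y * z;
  qb_span : forall u, exists s, u = combination qmon s;
  qb_free : forall s, combination qmon s = 0 ->
    forall e, combination e s = 0
}.

End QuantumBasis.

Lemma qcommXz (K : fieldType) (U : unitAlgType K) (q : K) (x y : U) (a : int) :
  q != 0 -> x \is a GRing.unit -> x * y = q *: (y * x) ->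
  x ^ a * y = q ^ a *: (y * x ^ a).
Proof.
move=> q0 xU xy.
have xyn (n : nat) : x ^+ n * y = q ^+ n *: (y * x ^+ n).
  elim: n => [|n IH]; first by rewrite !expr0 mul1r mulr1 scale1r.
  rewrite {1}exprSr -mulrA xy -scalerAr [x ^+ n * _]mulrA IH -scalerAl scalerA.
  by rewrite -exprS -mulrA -exprSr.
case: a => n; first exact: xyn.
rewrite !NegzE -!exprnN; apply: (mulrI (unitrX n.+1 xU)).
rewrite mulVKr ?unitrX // -scalerAr mulrA xyn -scalerAl scalerA.
by rewrite mulVf ?expf_neq0 // scale1r mulrK ?unitrX.
Qed.

(** * The ordered monomials form a basis of the localization *)

Section Localization.
Variables (K : fieldType) (q : K) (q_neq0 : q != 0).
Variables (T : algType K) (a11 a12 a22 : T) (presT : is_Tq2 q a11 a12 a22).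
Variables (U : unitAlgType K) (iota : {lrmorphism T -> U}).
Variables (locU : is_UTq2 a11 a22 iota).

Let a := tnth [tuple a11; a12; a22].
Let x := iota a11.
Let y := iota a12.
Let w := iota a22.
Let z := x * w^-1.

Let aE : (a i11 = a11) * (a i12 = a12) * (a i22 = a22).
Proof. by rewrite /a !(tnth_nth 0) /= !inordK. Qed.

Let S : set T := smallest (@mult_set T) [set a11; a22].

Let S_a11 : S a11. Proof. by apply: sub_gen_smallest; left. Qed.
Let S_a22 : S a22. Proof. by apply: sub_gen_smallest; right. Qed.

Let xU : x \is a GRing.unit.
Proof. by have [SU _ _] := locU; apply: SU. Qed.
Let wU : w \is a GRing.unit.
Proof. by have [SU _ _] := locU; apply: SU. Qed.
Let zU : z \is a GRing.unit.
Proof. by rewrite unitrMl ?unitrV. Qed.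

Lemma Tq2_relationsE :
  [/\ a22 * a12 = q *: (a12 * a22), a11 * a12 = q *: (a12 * a11)
    & a11 * a22 = a22 * a11].
Proof.
have [phi [phia _ ker]] := presT.
have rel0 f : Tq2_relations q f -> phi f = 0.
  by move=> rf; apply/ker; apply: sub_gen_smallest.
have relE f g : phi (f - g) = 0 -> phi f = phi g.
  by rewrite rmorphB => /eqP; rewrite subr_eq0 => /eqP.
have [p11 p12 p22] : [/\ phi (free_gen K i11) = a11,
    phi (free_gen K i12) = a12 & phi (free_gen K i22) = a22].
  by split; rewrite phia -/a aE.
rewrite -p11 -p12 -p22; split; [rewrite -2!rmorphM -linearZ
  |rewrite -2!rmorphM -linearZ|rewrite -2!rmorphM]; apply/relE/rel0.
- by do 2 left.
- by left; right.
- by right.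
Qed.

Let xy : x * y = q *: (y * x).
Proof. by have [_ E _] := Tq2_relationsE; rewrite -!rmorphM E; exact: linearZ. Qed.
Let wy : w * y = q *: (y * w).
Proof. by have [E _ _] := Tq2_relationsE; rewrite -!rmorphM E; exact: linearZ. Qed.
Let xw : x * w = w * x.
Proof. by have [_ _ E] := Tq2_relationsE; rewrite -!rmorphM E. Qed.

Let zx : z * x = x * z.
Proof. by rewrite /z -mulrA; congr (_ * _); exact: esym (commrV xw). Qed.
Let zy : z * y = y * z.
Proof.
have wVy : w^-1 * y = q^-1 *: (y * w^-1).
  apply: (mulrI wU); rewrite mulVKr // -scalerAr mulrA wy.
  by rewrite -scalerAl scalerA mulVf // scale1r mulrK.
rewrite /z -mulrA wVy -scalerAr [x * (y * _)]mulrA xy -scalerAl scalerA mulVf //.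
by rewrite scale1r mulrA.
Qed.

Local Notation mon := (qmon x y z).

Let word_image (phi : {lrmorphism free_alg K 3 -> T})
    (phia : forall i, phi (free_gen K i) = a i) v :
  phi (word K v) = \prod_(i <- v) a i.
Proof.
elim: v => [|i v IH]; first by rewrite big_nil word_nil rmorph1.
by rewrite (word_cat K [:: i]) rmorphM /= word1 phia IH big_cons.
Qed.

(** [normal_form] applies to a denominator only after lifting it to a word; without [i12] that word
    creates no inversions at the right end of a sorted one. *)
Lemma denominatorP s : S s ->
  exists2 v, count_mem i12 v = 0%N & s = \prod_(i <- v) a i.
Proof.
move: s; apply: smallest_sub; first split.
- by exists [::]; rewrite ?big_nil.
- move=> _ _ [u u0 ->] [v v0 ->]; exists (u ++ v); last by rewrite big_cat.
  by rewrite count_cat u0 v0.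
- move=> _ [->|->]; [exists [:: i11]|exists [:: i22]];
    by rewrite ?big_seq1 ?aE //= gen_eqE.
Qed.

Let zE b : z ^ b = x ^ b * w ^ (- b).
Proof.
by rewrite /z exprMz_comm ?unitrV // ?exprz_inv //; exact: commrV xw.
Qed.

(** As z^b = x^b w^(-b), the product is y^j x^(N+c+b) w^(N-b) for m = (j, c, b), and the bound makes
    the last two exponents nonnegative. *)
Let clear_denominator (N : nat) (m : exponent) :
    (absz (m.1.2 + m.2)%R + absz m.2 <= N)%N ->
  mon m * (x ^+ N * w ^+ N) = iota (\prod_(i <- nseq m.1.1 i12 ++
    (nseq (absz (N%:Z + m.1.2 + m.2)) i11 ++ nseq (absz (N%:Z - m.2)) i22)) a i).
Proof.
case: m => [[j c] b] /= leN.
have prodE i n : iota (\prod_(i <- nseq n i) a i) = iota (a i) ^+ n.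
  by rewrite rmorph_prod big_nseq; elim: n => //= n ->; rewrite exprS.
rewrite !big_cat /= !rmorphM /= !prodE !aE -/x -/y -/w /qmon zE /=.
have absX (t : U) (n : int) : 0 <= n -> t ^+ absz n = t ^ n.
  by move=> n0; rewrite exprnP gez0_abs.
rewrite !absX; try lia.
rewrite -addrA [N%:Z + _]addrC [N%:Z - b]addrC !exprzDr // -!mulrA.
congr (_ * (_ * (_ * _))); rewrite !mulrA; congr (_ * _).
exact: (commrXz N (commr_sym (commrXz (- b) xw))).
Qed.

(** Once denominators are cleared, vanishing in U means that some multiple by a denominator vanishes
    in T. Its lift lies in the ideal of relations, hence is killed by every [normal_form h]. *)
Let mon_free s : combination mon s = 0 ->
  forall e : exponent -> U, combination e s = 0.
Proof.
have [phi [phia _ ker]] := presT; have [_ _ iota0] := locU.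
move=> s0 e; pose N := (\sum_(p <- s) (absz (p.2.1.2 + p.2.2)%R + absz p.2.2))%N.
have leN p : p \in s -> (absz (p.2.1.2 + p.2.2)%R + absz p.2.2 <= N)%N.
  by move=> sp; rewrite /N (big_rem _ sp) leq_addr.
pose v (m : exponent) :=
  nseq (absz (N%:Z + m.1.2 + m.2)) i11 ++ nseq (absz (N%:Z - m.2)) i22.
pose f := \sum_(p <- s) p.1 *: word K (nseq p.2.1.1 i12 ++ v p.2).
have : iota (phi f) = 0.
  rewrite -[RHS](mul0r (x ^+ N * w ^+ N)) -s0 mulr_suml /f !linear_sum.
  apply: eq_big_seq => p sp.
  by rewrite -scalerAl clear_denominator ?leN // !linearZ /= (word_image phia).
case/iota0 => _ /denominatorP[d d0 ->]; rewrite -(word_image phia) -rmorphM.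
move/ker => f0.
(* [h] recovers the exponents from the letter counts by undoing the shifts due to N and to the
   denominator [d]. *)
pose h a b c := let b' := N%:Z + (count_mem i22 d)%:Z - c%:Z in
  e (b, a%:Z - N%:Z - (count_mem i11 d)%:Z - b', b').
rewrite -[RHS](normal_form_relations h f0) /f mulr_suml linear_sum.
apply: eq_big_seq => p sp; rewrite -scalerAl linearZ /= -word_cat.
have vd0 : count_mem i12 (v p.2 ++ d) = 0%N.
  by rewrite !count_cat d0 !count_nseq /= !gen_eqE.
rewrite normal_form_word -catA inversions_sorted // expr0 scale1r.
rewrite count_cat [count_mem i22 _]count_cat [count_mem i12 _]count_cat vd0.
rewrite !count_cat !count_nseq /= !eqxx !gen_eqE /h.
congr (_ *: e _); move: (leN p sp); case: (p.2) => [[j c] b] /= le_N.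
by congr (_, _, _); lia.
Qed.

(** The span is shown stable under right multiplication by y and by integer powers of x, z and w;
    starting from 1, this reaches every fraction. *)
Let spanned u := exists s, u = combination mon s.

Let spanned_lin k u v : spanned u -> spanned v -> spanned (k *: u + v).
Proof.
move=> [s ->] [t ->]; exists ([seq (k * p.1, p.2) | p <- s] ++ t).
rewrite /combination big_cat big_map scaler_sumr; congr (_ + _).
by apply: eq_bigr => p _; rewrite scalerA.
Qed.

Let spanned0 : spanned 0.
Proof. by exists [::]; rewrite /combination big_nil. Qed.

Let spannedZ k u : spanned u -> spanned (k *: u).
Proof. by move=> su; rewrite -[_ *: _]addr0; exact: spanned_lin. Qed.

Let spanned_mon m : spanned (mon m).
Proof. by exists [:: (1, m)]; rewrite /combination big_seq1 scale1r. Qed.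

Let spanned_mulr g : (forall m, spanned (mon m * g)) ->
  forall u, spanned u -> spanned (u * g).
Proof.
move=> sg _ [s ->]; rewrite /combination mulr_suml.
elim/big_rec: _ => // p v _; rewrite -scalerAl; exact: spanned_lin.
Qed.

Let spanned_x n u : spanned u -> spanned (u * x ^ n).
Proof.
apply: spanned_mulr => -[[j c] b]; rewrite /qmon /= -mulrA.
rewrite (commrXz n (commr_sym (commrXz b (commr_sym zx)))) mulrA -[_ * x ^ n]mulrA.
by rewrite -exprzDr //; exact: (spanned_mon (j, c + n, b)).
Qed.

Let spanned_z n u : spanned u -> spanned (u * z ^ n).
Proof.
apply: spanned_mulr => -[[j c] b]; rewrite /qmon /= -mulrA -exprzDr //.
exact: (spanned_mon (j, c, b + n)).
Qed.

Let spanned_w n u : spanned u -> spanned (u * w ^ n).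
Proof.
have -> : w ^ n = x ^ n * z ^ (- n).
  by rewrite zE opprK mulrA -exprzDr // subrr mul1r.
by move=> su; rewrite mulrA; apply/spanned_z/spanned_x.
Qed.

Let spanned_y u : spanned u -> spanned (u * y).
Proof.
apply: spanned_mulr => -[[j c] b]; rewrite /qmon /= -mulrA.
rewrite (commr_sym (commrXz b (commr_sym zy))) mulrA -[_ * y]mulrA.
rewrite (qcommXz c q_neq0 xU xy) -scalerAr mulrA -exprSr -scalerAl.
exact/spannedZ/(spanned_mon (j.+1, c, b)).
Qed.

Let spanned_gen i u : spanned u -> spanned (u * iota (a i)).
Proof.
move=> su; have [->|[->|->]] := gen_case i; rewrite aE.
- exact: (spanned_x 1).
- exact: spanned_y.
- exact: (spanned_w 1).
Qed.

Let spanned_iota t : spanned (iota t).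
Proof.
have [phi [phia phi_onto _]] := presT; have [f <-] := phi_onto t.
elim/free_alg_span: f => [|k f g sf sg|v]; first by rewrite !rmorph0.
  by rewrite 2!linearP; exact: spanned_lin.
rewrite (word_image phia); elim/last_ind: v => [|v i sv].
  by rewrite big_nil rmorph1; have := spanned_mon (0%N, 0, 0); rewrite /qmon !mul1r.
by rewrite big_rcons rmorphM; exact: spanned_gen.
Qed.

Let mon_span u : spanned u.
Proof.
have [_ frac _] := locU; have [t [_ [/denominatorP[d d0 ->] ->]]] := frac u.
(* Invertibility is carried through the induction because [invrM] needs both factors to be units. *)
suff: iota (\prod_(i <- d) a i) \is a GRing.unit /\
    forall v, spanned v -> spanned (v / iota (\prod_(i <- d) a i)).
  by case=> _; apply.
elim: d d0 => [|i d IH] /=.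
  by rewrite big_nil rmorph1 invr1 unitr1; split=> // v; rewrite mulr1.
rewrite big_cons rmorphM /=.
have [->|[->|->]] := gen_case i; rewrite ?gen_eqE ?eqxx // add0n => /IH[dU dspan];
  rewrite aE -/x -/w; split; rewrite ?unitrMl // => v sv; rewrite invrM // mulrA.
- exact/(spanned_x (-1))/dspan.
- exact/(spanned_w (-1))/dspan.
Qed.

Lemma localization_quantum_basis : quantum_basis x y z q.
Proof. by split. Qed.

End Localization.

(** * Laurent polynomials in z *)

Section Laurent.
Variables (K : fieldType) (U : unitAlgType K) (z : U).

(** Lists of pairs may repeat an exponent, so adding is concatenating; conversely the coefficients
    of equal exponents are collected. *)
Lemma laurentP u : laurent z u <->
  exists s : seq (K * int), u = \sum_(p <- s) p.1 *: z ^ p.2.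
Proof.
split=> [[r [c ->]]|[s ->]].
  by exists [seq (c i, i) | i <- r]; rewrite big_map.
exists (undup [seq p.2 | p <- s]), (fun i => \sum_(p <- s | p.2 == i) p.1).
under [RHS]eq_bigr do rewrite scaler_suml.
rewrite (exchange_big_dep predT) //=; apply: eq_big_seq => p sp.
under eq_bigl do rewrite eq_sym.
by rewrite -big_filter filter_pred1_uniq ?undup_uniq ?mem_undup ?map_f // big_seq1.
Qed.

Lemma laurent_lin k u v :
  laurent z u -> laurent z v -> laurent z (k *: u + v).
Proof.
move=> /laurentP[s ->] /laurentP[t ->]; apply/laurentP.
exists ([seq (k * p.1, p.2) | p <- s] ++ t); rewrite big_cat big_map scaler_sumr.
by congr (_ + _); apply: eq_bigr => p _; rewrite scalerA.
Qed.

Lemma laurent0 : laurent z 0.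
Proof. by apply/laurentP; exists [::]; rewrite big_nil. Qed.

Lemma laurentX i : laurent z (z ^ i).
Proof. by apply/laurentP; exists [:: (1, i)]; rewrite big_seq1 scale1r. Qed.

End Laurent.

(** * Generalities on derivations and inner derivations *)

Section DerivationTheory.
Variables (K : fieldType) (A : unitAlgType K).
Implicit Types (D E : Der A) (u v : A).

Fact der_linear D : linear D.
Proof. by have /derivationP[] := valP D. Qed.
HB.instance Definition _ D :=
  GRing.isLinear.Build K A A _ (der_fun D) (der_linear D).

Lemma derM D u v : D (u * v) = D u * v + u * D v.
Proof. by have /derivationP[_] := valP D; apply. Qed.

Lemma der_ext D E : D =1 E -> D = E.
Proof. by move=> DE; apply: val_inj; apply/funext. Qed.

Lemma der1 D : D 1 = 0.
Proof.
by apply: (addrI (D 1)); rewrite addr0 -[RHS](congr1 D (mulr1 1)) derM mulr1 mul1r.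
Qed.

Lemma derM0 D u v : D u = 0 -> D v = 0 -> D (u * v) = 0.
Proof. by rewrite derM => -> ->; rewrite mul0r mulr0 addr0. Qed.

Lemma derV0 D u : u \is a GRing.unit -> D u = 0 -> D u^-1 = 0.
Proof.
move=> uU Du; apply: (mulrI uU); rewrite mulr0.
by have := derM D u u^-1; rewrite Du mul0r add0r mulrV // der1.
Qed.

Lemma derX0 D u n : D u = 0 -> D (u ^+ n) = 0.
Proof.
move=> Du; elim: n => [|n IH]; first by rewrite expr0 der1.
by rewrite exprS derM0.
Qed.

Lemma derXz0 D u (n : int) : u \is a GRing.unit -> D u = 0 -> D (u ^ n) = 0.
Proof.
move=> uU Du; case: n => n; first exact: derX0.
by rewrite NegzE -exprnN derV0 ?unitrX // derX0.
Qed.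

(** In the derivative of u v = v u the terms containing D v cancel, since u commutes with D v. *)
Lemma der_central D u : u \in @central A -> D u \in @central A.
Proof.
move=> /centralP uC; apply/centralP => v.
have := congr1 D (uC v); rewrite !derM (uC (D v)) => E.
by apply: (addIr (D v * u)); rewrite E addrC.
Qed.

Fact inner_subproof a : (fun u => a * u - u * a) \in @derivation K A.
Proof.
apply/derivationP; split=> [k u v|u v].
  by rewrite mulrDr mulrDl -scalerAr -scalerAl scalerBr opprD addrACA.
by rewrite mulrBl mulrBr !mulrA addrA subrK.
Qed.
Definition inner a : Der A := MkDer (inner_subproof a).

Lemma inner_IDer a : inner a \in @IDer K A.
Proof. by apply/IDerP; exists a. Qed.

Lemma IDer_inner D : D \in @IDer K A -> exists a, D = inner a.
Proof. by move=> /IDerP[a Da]; exists a; apply: der_ext. Qed.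

End DerivationTheory.

(** * Linear extension and diagonal operators on a quantum basis *)

Section QuantumBasisTheory.
Variables (K : fieldType) (q : K) (q_neq0 : q != 0).
Hypothesis q_nroot : forall n : nat, (0 < n)%N -> q ^+ n != 1.
Variables (U : unitAlgType K) (x y z : U) (basis : quantum_basis x y z q).
Implicit Types (u v : U) (m : exponent) (h g : exponent -> K).

Local Notation mon := (qmon x y z).

Let xU := qb_unitx basis.
Let zU := qb_unitz basis.
Let xy := qb_xy basis.
Let zx := qb_zx basis.
Let zy := qb_zy basis.

Lemma qmon_ind (P : U -> Prop) :
  P 0 -> (forall k u v, P u -> P v -> P (k *: u + v)) ->
  (forall m, P (mon m)) -> forall u, P u.
Proof.
move=> P0 PD Pm u; have [s ->] := qb_span basis u.
by rewrite /combination; elim/big_rec: _ => // p v _; exact: PD.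
Qed.

(** An expansion of each element is chosen; by [qb_free], two expansions of the same element give
    the same combination of [e], whence linearity. *)
Lemma qext_exists (e : exponent -> U) :
  exists L : {linear U -> U}, forall m, L (mon m) = e m.
Proof.
pose s u := sval (cid (qb_span basis u)).
have sE u : combination mon (s u) = u by rewrite /s; case: cid.
have eE t : combination e (s (combination mon t)) = combination e t.
  apply/eqP; rewrite -subr_eq0; apply/eqP.
  pose d := s (combination mon t) ++ [seq (- p.1, p.2) | p <- t].
  have dE f : combination f d =
      combination f (s (combination mon t)) - combination f t.
    rewrite /combination big_cat big_map -sumrN; congr (_ + _).
    by apply: eq_bigr => p _; rewrite scaleNr.
  by rewrite -dE; apply: (qb_free basis); rewrite dE sE subrr.
have Llin : linear (fun u => combination e (s u)).
  move=> k u v; pose t := [seq (k * p.1, p.2) | p <- s u] ++ s v.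
  have tE f : combination f t = k *: combination f (s u) + combination f (s v).
    rewrite /combination big_cat big_map scaler_sumr; congr (_ + _).
    by apply: eq_bigr => p _; rewrite scalerA.
  by rewrite -tE -[RHS]eE tE !sE.
pose L := GRing.isLinear.Build K U U _ _ Llin.
pose L' : {linear U -> U} := HB.pack (fun u => combination e (s u)) L.
exists L' => m /=.
have -> : mon m = combination mon [:: (1, m)].
  by rewrite /combination big_seq1 scale1r.
by rewrite eE /combination big_seq1 scale1r.
Qed.

Definition qext (e : exponent -> U) : {linear U -> U} :=
  sval (cid (qext_exists e)).

Lemma qextE e m : qext e (mon m) = e m.
Proof. by rewrite /qext; case: cid. Qed.

(** These operators stand in for coordinates: [diag h u = 0] says that u involves only monomials on
    which h vanishes. *)
Definition diag h : {linear U -> U} := qext (fun m => h m *: mon m).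

Lemma diagE h m : diag h (mon m) = h m *: mon m.
Proof. exact: qextE. Qed.

Lemma diag_comp h g u : diag h (diag g u) = diag (fun m => h m * g m) u.
Proof.
elim/qmon_ind: u => [|k u v IHu IHv|m]; first by rewrite !linear0.
  by rewrite !linearP IHu IHv.
by rewrite !diagE linearZ /= diagE scalerA mulrC.
Qed.

Lemma eq_diag h g u : h =1 g -> diag h u = diag g u.
Proof. by move=> /funext ->. Qed.

Lemma diagD h g u : diag (fun m => h m + g m) u = diag h u + diag g u.
Proof.
elim/qmon_ind: u => [|k u v IHu IHv|m]; first by rewrite !linear0 addr0.
  by rewrite !linearP IHu IHv scalerDr addrACA.
by rewrite !diagE scalerDl.
Qed.

Lemma diag1 u : diag (fun=> 1) u = u.
Proof.
elim/qmon_ind: u => [|k u v IHu IHv|m]; first by rewrite !linear0.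
  by rewrite !linearP IHu IHv.
by rewrite diagE scale1r.
Qed.

Lemma diagZ k h u : diag (fun m => k * h m) u = k *: diag h u.
Proof.
have -> : k *: diag h u = diag (fun=> k) (diag h u); last by rewrite diag_comp.
elim/qmon_ind: (diag h u) => [|l v w IHv IHw|m]; first by rewrite !linear0.
  by rewrite linearP -IHv -IHw scalerDr !scalerA mulrC.
by rewrite diagE.
Qed.

(** Apply the operator of weight g / h; where h vanishes so does g, and division by zero does no
    harm. *)
Lemma diag_eq0 h g u : diag h u = 0 -> (forall m, h m = 0 -> g m = 0) ->
  diag g u = 0.
Proof.
move=> hu0 hg; rewrite -(linear0 (diag (fun m => g m / h m))) -hu0 diag_comp.
apply: eq_diag => m; have [h0|hN0] := eqVneq (h m) 0; last by rewrite divfK.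
by rewrite h0 mulr0 hg.
Qed.

Lemma diag_id h g u : diag h u = 0 -> (forall m, h m = 0 -> g m = 1) ->
  diag g u = u.
Proof.
move=> hu0 hg; rewrite -[RHS]diag1 -[LHS]addr0.
have <- : diag (fun m => 1 - g m) u = 0.
  by apply: (diag_eq0 hu0) => m /hg ->; rewrite subrr.
by rewrite -diagD; apply: eq_diag => m; rewrite addrC subrK.
Qed.

Lemma diag0 h u : (forall m, h m = 0) -> diag h u = 0.
Proof.
move=> h0; elim/qmon_ind: u => [|k u v IHu IHv|m]; first by rewrite linear0.
  by rewrite linearP IHu IHv scaler0 addr0.
by rewrite diagE h0 scale0r.
Qed.

(** * Multiplication of monomials, commutators and the center *)

Lemma qmonM m m' : mon m * mon m' = q ^ (m.1.2 * m'.1.1%:Z) *: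
  mon ((m.1.1 + m'.1.1)%N, m.1.2 + m'.1.2, m.2 + m'.2).
Proof.
case: m m' => [[j a] b] [[j' a'] b']; rewrite /qmon /=.
have xyn : x ^ a * y ^+ j' = q ^ (a * j'%:Z) *: (y ^+ j' * x ^ a).
  elim: j' => [|n IH]; first by rewrite mulr0 expr0z scale1r mulr1 mul1r.
  rewrite {1}exprSr mulrA IH -scalerAl -[_ * _ * y]mulrA.
  rewrite (qcommXz a q_neq0 xU xy) -scalerAr scalerA -expfzDr // mulrA -exprSr.
  by congr (q ^ _ *: _); rewrite -addn1 PoszD mulrDr mulr1.
have zC : z ^ b * (y ^+ j' * x ^ a') = y ^+ j' * x ^ a' * z ^ b.
  by apply/commr_sym/commrXz/commr_sym/commrM; [apply: commrX | apply: commrXz].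
rewrite exprD !exprzDr // -[_ * z ^ b * _]mulrA [z ^ b * _]mulrA zC -!mulrA.
by rewrite [x ^ a * _]mulrA xyn -scalerAl -scalerAr -!mulrA.
Qed.

Let xE : x = mon (0%N, 1, 0).
Proof. by rewrite /qmon /= mul1r mulr1. Qed.
Let yE : y = mon (1%N, 0, 0).
Proof. by rewrite /qmon /= !mulr1. Qed.
Let zE : z = mon (0%N, 0, 1).
Proof. by rewrite /qmon /= !mul1r. Qed.

Lemma qmon_x j a b : mon (j, a, b) * x = mon (j, a + 1, b).
Proof.
have := qmonM (j, a, b) (0%N, 1, 0); rewrite -xE /= => ->.
by rewrite mulr0 expr0z scale1r addn0 addr0.
Qed.

Lemma x_qmon j a b : x * mon (j, a, b) = q ^+ j *: mon (j, a + 1, b).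
Proof.
have := qmonM (0%N, 1, 0) (j, a, b); rewrite -xE /= => ->.
by rewrite mul1r add0n add0r addrC.
Qed.

Lemma qmon_y j a b : mon (j, a, b) * y = q ^ a *: mon (j.+1, a, b).
Proof.
have := qmonM (j, a, b) (1%N, 0, 0); rewrite -yE /= => ->.
by rewrite mulr1 addn1 !addr0.
Qed.

Lemma y_qmon j a b : y * mon (j, a, b) = mon (j.+1, a, b).
Proof.
have := qmonM (1%N, 0, 0) (j, a, b); rewrite -yE /= => ->.
by rewrite mul0r expr0z scale1r add1n !add0r.
Qed.

(** Under [diag] the two indicators become the projections to y-degree 0 and x-degree 0; the two
    weights are the factors met in commutators with x and y. *)
Definition ydeg0 : exponent -> K := fun m => (m.1.1 == 0%N)%:R.
Definition xdeg0 : exponent -> K := fun m => (m.1.2 == 0)%:R.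
Definition xweight : exponent -> K := fun m => 1 - q ^+ m.1.1.
Definition yweight : exponent -> K := fun m => q ^ m.1.2 - 1.

(** Here and in [yweight_eq0], q not being a root of unity excludes further zeros of the weights. *)
Lemma xweight_eq0 m : (xweight m == 0) = (m.1.1 == 0%N).
Proof.
rewrite /xweight subr_eq0 eq_sym; case: m.1.1 => [|n]; first by rewrite expr0 !eqxx.
exact/negbTE/q_nroot.
Qed.

Lemma yweight_eq0 m : (yweight m == 0) = (m.1.2 == 0).
Proof.
rewrite /yweight subr_eq0; case: m.1.2 => [[|n]|n]; first by rewrite !eqxx.
  exact/negbTE/q_nroot.
by rewrite NegzE -exprnN invr_eq1; exact/negbTE/q_nroot.
Qed.

(** Left and right multiplication by x shift a monomial in the same way, up to the factor q^j.
    Solving a x - x a = u x for a thus amounts to dividing by weights; [commutator_y] serves the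
    same purpose for y. *)
Lemma commutator_x u : u * x - x * u = diag xweight u * x.
Proof.
elim/qmon_ind: u => [|k u v IHu IHv|[[j a] b]].
- by rewrite !linear0 mul0r mulr0 subrr.
- rewrite linearP mulrDl mulrDr [RHS]mulrDl -!scalerAl -scalerAr -IHu -IHv.
  by rewrite scalerBr opprD addrACA.
rewrite diagE -scalerAl qmon_x x_qmon /xweight /=.
by rewrite scalerBl scale1r.
Qed.

Lemma commutator_y u : u * y - y * u = y * diag yweight u.
Proof.
elim/qmon_ind: u => [|k u v IHu IHv|[[j a] b]].
- by rewrite !linear0 mul0r mulr0 subrr.
- rewrite linearP mulrDl mulrDr [RHS]mulrDr -scalerAl -!scalerAr -IHu -IHv.
  by rewrite scalerBr opprD addrACA.
rewrite diagE -scalerAr qmon_y y_qmon /yweight /=.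
by rewrite scalerBl scale1r.
Qed.

Lemma comm_z u : z * u = u * z.
Proof.
elim/qmon_ind: u => [|k u v IHu IHv|m]; first by rewrite mul0r mulr0.
  by rewrite mulrDl mulrDr -scalerAl -scalerAr IHu IHv.
by apply: commrM; [apply: commrM; [apply: commrX | apply: commrXz] | apply: commrXz].
Qed.

(** As y has no inverse, it is cancelled on the left by this map. The value 0 in y-degree 0 is used
    in [ydeg1_lower], which extracts v from the component y v of y-degree 1. *)
Definition lower : {linear U -> U} := qext (fun m =>
  if m.1.1 is j.+1 then mon (j, m.1.2, m.2) else 0).

Lemma lowerK : cancel ( *%R y) lower.
Proof.
move=> u; elim/qmon_ind: u => [|k u v IHu IHv|[[j a] b]].
- by rewrite mulr0 linear0.
- by rewrite mulrDr -scalerAr linearP IHu IHv.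
- by rewrite y_qmon qextE.
Qed.

Lemma diag_y h u : diag h (y * u) = y * diag (fun m => h (m.1.1.+1, m.1.2, m.2)) u.
Proof.
elim/qmon_ind: u => [|k u v IHu IHv|[[j a] b]].
- by rewrite linear0 !mulr0 linear0.
- by rewrite linearP !mulrDr -!scalerAr linearP IHu IHv.
- by rewrite y_qmon !diagE -scalerAr y_qmon.
Qed.

Lemma ydeg1_lower u :
  diag (fun m => (m.1.1 == 1%N)%:R) u = y * diag ydeg0 (lower u).
Proof.
elim/qmon_ind: u => [|k u v IHu IHv|[[[|j] a] b]].
- by rewrite !linear0 mulr0.
- by rewrite !linearP mulrDr -scalerAr IHu IHv.
- by rewrite diagE scale0r [lower _]qextE linear0 mulr0.
- by rewrite diagE [lower _]qextE diagE -scalerAr y_qmon.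
Qed.

(** Commuting with x and y suffices because z is central and the monomials span. Conversely x is
    cancelled as a unit and y by [lower]. *)
Lemma central_diag u : u \in @central U <->
  diag xweight u = 0 /\ diag yweight u = 0.
Proof.
split=> [/centralP uC|[ux0 uy0]].
  split.
    by apply: (mulIr xU); rewrite mul0r -commutator_x uC subrr.
  by apply: (can_inj lowerK); rewrite /= mulr0 -commutator_y uC subrr.
have ux : GRing.comm u x by apply/eqP; rewrite -subr_eq0 commutator_x ux0 mul0r.
have uy : GRing.comm u y by apply/eqP; rewrite -subr_eq0 commutator_y uy0 mulr0.
apply/centralP => v; elim/qmon_ind: v => [|k v w IHv IHw|m].
- by rewrite mul0r mulr0.
- by rewrite mulrDl mulrDr -scalerAl -scalerAr IHv IHw.
apply: commrM; last exact/commrXz/esym/comm_z.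
by apply: commrM; [apply: commrX | apply: commrXz].
Qed.

Lemma central_z i : z ^ i \in @central U.
Proof. by apply/centralP => u; exact: commr_sym (commrXz i (esym (comm_z u))). Qed.

Lemma central_laurent u : u \in @central U <-> laurent z u.
Proof.
split=> [/central_diag[ux0 uy0]|[r [c ->]]]; last first.
  apply/centralP => v; rewrite mulr_suml mulr_sumr; apply: eq_bigr => i _.
  by rewrite -scalerAl -scalerAr; have /centralP -> := central_z i.
(* A central u equals its projection to the monomials with j = a = 0, which are the powers of z. *)
have <- : diag (fun m => ydeg0 m * xdeg0 m) u = u.
  by rewrite -diag_comp (diag_id uy0) ?(diag_id ux0) // => m /eqP;
    rewrite ?xweight_eq0 ?yweight_eq0 /ydeg0 /xdeg0 => ->.
elim/qmon_ind: (u) => [|k v w IHv IHw|[[j a] b]].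
- by rewrite linear0; exact: laurent0.
- by rewrite linearP; exact: laurent_lin.
rewrite diagE /ydeg0 /xdeg0 -natrM mulnb /=.
case: eqP => [->|_]; last by rewrite scale0r; exact: laurent0.
case: eqP => [->|_]; last by rewrite scale0r; exact: laurent0.
by rewrite scale1r /qmon /= !mul1r; exact: laurentX.
Qed.

(** The projection to z-degree i isolates one term, and the unit z^i is not 0. *)
Lemma z_laurent_free : laurent_free z.
Proof.
move=> r c r_uniq r0 i ri.
have zX j : z ^ j = mon (0%N, 0, j) by rewrite /qmon !mul1r.
have : diag (fun m => (m.2 == i)%:R) (\sum_(i <- r) c i *: z ^ i) = c i *: z ^ i.
  rewrite linear_sum (bigD1_seq i) //= big1 => [|j /negbTE ij];
    by rewrite linearZ /= zX diagE /= ?ij ?eqxx ?scale0r ?scaler0 ?scale1r ?addr0.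
rewrite r0 linear0 => /esym/eqP; rewrite scaler_eq0 => /orP[/eqP //|/eqP zi0].
by have := unitrXz i zU; rewrite zi0 unitr0.
Qed.

(** * Diagonal derivations *)

(* In terms of the original generators, D11, D12 and D22 have weights
   (cy, cx, cz) = (0, 1, 1), (1, 0, 0) and (0, 0, -1), as a22 = x z^-1. *)
Definition degree (cy cx cz : K) m : K :=
  cy * m.1.1%:R + cx * m.1.2%:~R + cz * m.2%:~R.

(** [degree] is additive in the exponents and a product of monomials is a scalar multiple of a
    monomial, so the Leibniz rule holds on monomials and extends bilinearly. *)
Fact euler_subproof cy cx cz : (diag (degree cy cx cz) : U -> U) \in @derivation K U.
Proof.
apply/derivationP; split=> [k u v|u v]; first exact: linearP.
elim/qmon_ind: u => [|k u1 u2 IH1 IH2|m].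
- by rewrite linear0 !mul0r linear0 addr0.
- rewrite mulrDl -scalerAl !linearP IH1 IH2 !mulrDl -!scalerAl scalerDr.
  exact: addrACA.
elim/qmon_ind: v => [|k v1 v2 IH1 IH2|m'].
- by rewrite linear0 !mulr0 linear0 addr0.
- rewrite mulrDr -scalerAr !linearP IH1 IH2 !mulrDr -!scalerAr scalerDr.
  exact: addrACA.
rewrite !diagE -scalerAl -scalerAr -scalerDl qmonM linearZ /= diagE !scalerA mulrC.
by congr (_ * _ *: _); rewrite /degree natrD !intrD; ring.
Qed.
Definition euler cy cx cz : Der U := MkDer (euler_subproof cy cx cz).

Lemma eulerE cy cx cz m : euler cy cx cz (mon m) = degree cy cx cz m *: mon m.
Proof. exact: diagE. Qed.

Lemma euler_x cy cx cz : euler cy cx cz x = cx *: x.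
Proof. by rewrite xE eulerE /degree /= !mulr0 mulr1 add0r addr0. Qed.
Lemma euler_y cy cx cz : euler cy cx cz y = cy *: y.
Proof. by rewrite yE eulerE /degree /= !mulr0 mulr1 !addr0. Qed.
Lemma euler_z cy cx cz : euler cy cx cz z = cz *: z.
Proof. by rewrite zE eulerE /degree /= !mulr0 mulr1 !add0r. Qed.

Lemma der_eq (D E : Der U) : D x = E x -> D y = E y -> D z = E z -> D = E.
Proof.
move=> Ex Ey Ez; apply: der_ext => u; apply/eqP; rewrite -subr_eq0.
rewrite -[_ - _]/((D - E) u); apply/eqP.
elim/qmon_ind: u => [|k u v IHu IHv|m]; first exact: (linear0 (D - E)).
  by rewrite der_linear IHu IHv scaler0 addr0.
by apply: derM0; [apply: derM0; [apply: derX0 | apply: derXz0] | apply: derXz0];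
  rewrite //= !fctE ?Ex ?Ey ?Ez subrr.
Qed.

(** * Existence and uniqueness of the decomposition of a derivation *)

Local Notation D11 := (euler 0 1 1).
Local Notation D12 := (euler 1 0 0).
Local Notation D22 := (euler 0 0 (-1)).

(** Differentiating x y = q y x ties the commutator of c and y to D y. The second conclusion
    confines D y to y-degree 1 when q is not a root of unity. *)
Lemma der_z0_xy (D : Der U) (c : U) :
  D z = 0 -> diag xweight c = 0 -> D x = c * x ->
  c \in @central U /\ diag (fun m => q - q ^+ m.1.1) (D y) = 0.
Proof.
move=> Dz cx0 Dx.
have cj0 : diag ydeg0 c = c.
  by apply: (diag_id cx0) => m /eqP; rewrite xweight_eq0 /ydeg0 => ->.
have E : q *: (y * diag yweight c) = diag (fun m => q - q ^+ m.1.1) (D y).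
  (* The Leibniz rule gives q (c y - y c) x = q (D y) x - x (D y); after cancelling x, the right
     side has weight (q - 1) + (1 - q^j) in y-degree j. *)
  transitivity (q *: D y - D y + diag xweight (D y)).
    apply: (mulIr xU); rewrite mulrDl mulrBl -commutator_x -commutator_y.
    have := congr1 D xy; rewrite linearZ /= !derM Dx -mulrA xy.
    rewrite -!scalerAl -!scalerAr !mulrBl scalerBr scalerDr !mulrA => e.
    rewrite addrA subrK.
    by apply/eqP; rewrite subr_eq addrAC -e addrK.
  rewrite -{1 2}(diag1 (D y)) -diagZ -scaleN1r -diagZ -!diagD.
  by apply: eq_diag => m; rewrite /xweight mulr1 mulN1r addrA subrK.
have F : y * diag yweight c = 0.
  (* In [E] the left side has y-degree 1, while the right side has no term of
     that degree. *)
  apply: (scalerI q_neq0); rewrite scaler0.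
  have <- : diag (fun m => (m.1.1 == 1%N)%:R) (q *: (y * diag yweight c)) =
      q *: (y * diag yweight c).
    rewrite linearZ /= diag_y diag_comp -{2}cj0 diag_comp.
    by congr (_ *: (_ * _)); apply: eq_diag => m; rewrite mulrC.
  rewrite E diag_comp; apply: diag0 => m.
  by case: eqP => [->|_]; rewrite ?mul0r // expr1 subrr mulr0.
split; last by rewrite -E F scaler0.
by apply/central_diag; split=> //; apply: (can_inj lowerK); rewrite /= mulr0.
Qed.

Lemma der_decomposition_z0 (D : Der U) : D z = 0 ->
  exists a (c d : center U), D = inner a + (c *: (D11 + D22) + d *: D12).
Proof.
move=> Dz; pose u := D x / x.
(* Since 0^-1 = 0, the weight times its inverse is 0 in y-degree 0 and 1 elsewhere, so subtracting
   [inner a1] leaves the y-degree 0 part of [u]. *)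
pose a1 := diag (fun m => (xweight m)^-1) u; pose D1 := D - inner a1.
have D1x : D1 x = diag ydeg0 u * x.
  rewrite -[D1 x]/(D x - (a1 * x - x * a1)) commutator_x diag_comp.
  rewrite -[D x](divrK xU) -/u -mulrBl; congr (_ * x).
  rewrite -[X in X - _]diag1 -scaleN1r -diagZ -diagD; apply: eq_diag => m.
  rewrite mulN1r /ydeg0; have := xweight_eq0 m; case: eqP => [-> <-|xw0 <-].
    by rewrite mul0r subr0.
  by rewrite divff ?subrr //; exact/eqP.
have D1z : D1 z = 0.
  by rewrite -[D1 z]/(D z - (a1 * z - z * a1)) Dz comm_z subrr subr0.
have cx0 : diag xweight (diag ydeg0 u) = 0.
  rewrite diag_comp; apply: diag0 => m; rewrite /ydeg0 -xweight_eq0.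
  by case: eqP => [->|_]; rewrite ?mul0r ?mulr0.
have [cC D1y] := der_z0_xy D1z cx0 D1x.
pose c := Center cC.
(* A zero of q - q^j at j = 0 would give q = 1, and one at j > 1 would give q^(j-1) = 1. *)
have : diag (fun m => (m.1.1 == 1%N)%:R) (D1 y) = D1 y.
  apply: (diag_id D1y) => -[[[|[|j]] a] b] //= /eqP.
    by rewrite expr0 subr_eq0 -[q]expr1 (negbTE (q_nroot _)).
  rewrite exprS -{1}[q]mulr1 -mulrBr mulf_eq0 (negbTE q_neq0) subr_eq0 eq_sym.
  by rewrite (negbTE (q_nroot _)).
rewrite ydeg1_lower; set v := diag ydeg0 _ => D1yE.
(* The same device for y leaves the x-degree 0 part of [v]. As [a2] is free of y, it commutes with x
   and does not disturb [D1 x]. *)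
pose a2 := diag (fun m => (yweight m)^-1) v.
have xw0 h : diag xweight (diag h v) = 0.
  rewrite /v !diag_comp; apply: diag0 => m; rewrite /ydeg0 -xweight_eq0.
  by case: eqP => [->|_]; rewrite ?mul0r ?mulr0.
have dC : diag xdeg0 v \in @central U.
  apply/central_diag; split; first exact: xw0.
  rewrite diag_comp; apply: diag0 => m; rewrite /xdeg0 -yweight_eq0.
  by case: eqP => [->|_]; rewrite ?mul0r ?mulr0.
exists (a1 + a2), c, (Center dC).
have -> : inner (a1 + a2) = inner a1 + inner a2.
  by apply: der_ext => w /=; rewrite !fctE mulrDl mulrDr opprD addrACA.
(* [D11 + D22] fixes x and kills y and z, so the values on x, y and z can be compared. *)
have E : D1 - inner a2 = c *: (D11 + D22) + Center dC *: D12.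
  have rhsE w : (c *: (D11 + D22) + Center dC *: D12) w =
      diag ydeg0 u * (D11 w + D22 w) + diag xdeg0 v * D12 w by [].
  have lhsE w : (D1 - inner a2) w = D1 w - (a2 * w - w * a2) by [].
  apply: der_eq; rewrite rhsE lhsE ?euler_x ?euler_y ?euler_z.
  - by rewrite commutator_x xw0 mul0r subr0 D1x scale1r !scale0r mulr0 !addr0.
  - rewrite commutator_y -D1yE -mulrBr scale1r !scale0r addr0 mulr0 add0r.
    have /centralP -> := dC; congr (y * _).
    rewrite diag_comp -[X in X - _]diag1 -scaleN1r -diagZ -diagD.
    apply: eq_diag => m; rewrite mulN1r /xdeg0; have := yweight_eq0 m.
    case: eqP => [-> <-|yw0 <-]; first by rewrite mul0r subr0.
    by rewrite divff ?subrr //; exact/eqP.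
  - by rewrite D1z comm_z subrr subr0 scale1r scaleN1r subrr scale0r !mulr0 addr0.
by rewrite -E /D1 -[_ - _ - _]addrA -opprD [RHS]addrC subrK.
Qed.

(** [D11] fixes z and D z / z is central, so subtracting (D z / z) [D11] reduces to the case D z =
    0. *)
Lemma der_decomposition (D : Der U) : exists a (c1 c2 c3 : center U),
  D = inner a + c1 *: D11 + c2 *: D12 + c3 *: D22.
Proof.
have cC : D z / z \in @central U.
  apply: rpredM; last exact: (central_z (-1)).
  by apply: der_central; apply/centralP => u; exact: comm_z.
have [|a [c [d E]]] := @der_decomposition_z0 (D - Center cC *: D11).
  by rewrite -[LHS]/(D z - (D z / z) * D11 z) euler_z scale1r divrK // subrr.
exists a, (Center cC + c), d, c.
rewrite -[LHS](subrK (Center cC *: D11)) E scalerDl scalerDr -!addrA.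
congr (_ + _); rewrite [RHS]addrCA; congr (_ + _).
by rewrite addrC [_ + Center cC *: _]addrC -addrA.
Qed.

(** Evaluation at z, where inner derivations vanish, gives c1 = c3. At x and then y, the commutator
    with a and the central coefficient live on disjoint sets of monomials, so c1 and c2 vanish. *)
Lemma der_decomposition_uniq a (c1 c2 c3 : center U) :
  inner a + c1 *: D11 + c2 *: D12 + c3 *: D22 = 0 ->
  [/\ c1 = 0, c2 = 0 & c3 = 0].
Proof.
move=> E.
have Ew w : a * w - w * a + val c1 * D11 w + val c2 * D12 w + val c3 * D22 w = 0.
  exact: (congr1 (fun D : Der U => D w) E).
have c0 (h : exponent -> K) (c : center U) :
    diag h a + val c = 0 -> diag h (val c) = 0 -> c = 0.
  (* Applying [diag h] again removes c; then [diag h (diag h a) = 0] forces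
     [diag h a = 0]. *)
  move=> hac hc; have := congr1 (diag h) hac.
  rewrite linear0 linearD /= hc addr0 diag_comp => ha.
  have ha0 : diag h a = 0.
    by apply: (diag_eq0 ha) => m /eqP; rewrite mulf_eq0 orbb => /eqP.
  by apply: val_inj; rewrite -[LHS]add0r -ha0 hac.
have cP (c : center U) := (central_diag (val c)).1 (valP c).
have c13 : c1 = c3.
  apply: val_inj; apply: (mulIr zU); have := Ew z.
  rewrite !euler_z comm_z subrr add0r scale1r scale0r mulr0 addr0 scaleN1r mulrN.
  by move/eqP; rewrite subr_eq0 => /eqP.
have c1_0 : c1 = 0.
  have [+ _] := cP c1; apply: c0; apply: (mulIr xU); have := Ew x.
  by rewrite !euler_x commutator_x scale1r !scale0r !mulr0 !addr0 -mulrDl mul0r.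
have c2_0 : c2 = 0.
  have [_ +] := cP c2; apply: c0; apply: (can_inj lowerK); have := Ew y.
  by rewrite !euler_y commutator_y scale1r !scale0r !mulr0 !addr0 centerC -mulrDr.
by rewrite -c13 c1_0 c2_0.
Qed.

(** * The direct sum and the first Hochschild cohomology *)

Lemma laurent_mulP (D E : Der U) :
  laurent_mul z D E <-> exists c : center U, E = c *: D.
Proof.
split=> [[f /central_laurent fC EE]|[c ->]].
  by exists (Center fC); apply: der_ext.
by exists (val c) => //; apply/central_laurent/valP.
Qed.

Lemma der_direct_sum : internal_direct_sum
  (tnth [tuple [set D | D \in @IDer K U]; laurent_mul z D11;
               laurent_mul z D12; laurent_mul z D22]).
Proof.
set W := tnth _.
have sum4 (w : 'I_4 -> Der U) :
    \sum_i w i = w (inord 0) + w (inord 1) + w (inord 2) + w (inord 3).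
  rewrite !big_ord_recl big_ord0 addr0 !addrA.
  by congr (w _ + w _ + w _ + w _); apply: val_inj; rewrite /= inordK.
have WE : [/\ W (inord 0) = [set D | D \in @IDer K U],
    W (inord 1) = laurent_mul z D11,
    W (inord 2) = laurent_mul z D12 & W (inord 3) = laurent_mul z D22].
  by rewrite /W; split; rewrite (tnth_nth set0) /= inordK.
have I4 (P : 'I_4 -> Prop) :
    P (inord 0) -> P (inord 1) -> P (inord 2) -> P (inord 3) -> forall i, P i.
  move=> P0 P1 P2 P3 i; rewrite -[i]inord_val.
  by case: i => [[|[|[|[|//]]]] ?].
case: WE => W0 W1 W2 W3; split=> [D|w w' Ww Ww'].
  have [a [c1 [c2 [c3 ->]]]] := der_decomposition D.
  pose w := tnth [tuple inner a; c1 *: D11; c2 *: D12; c3 *: D22].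
  have wE : [/\ w (inord 0) = inner a, w (inord 1) = c1 *: D11,
      w (inord 2) = c2 *: D12 & w (inord 3) = c3 *: D22].
    by rewrite /w; split; rewrite (tnth_nth 0) /= inordK.
  case: wE => w0 w1 w2 w3; exists w; last by rewrite sum4 w0 w1 w2 w3.
  apply: I4; rewrite ?W0 ?W1 ?W2 ?W3 ?w0 ?w1 ?w2 ?w3.
  - exact: inner_IDer.
  - by apply/laurent_mulP; exists c1.
  - by apply/laurent_mulP; exists c2.
  - by apply/laurent_mulP; exists c3.
move: (Ww (inord 0)) (Ww' (inord 0)) (Ww (inord 1)) (Ww' (inord 1)).
move: (Ww (inord 2)) (Ww' (inord 2)) (Ww (inord 3)) (Ww' (inord 3)).
rewrite !sum4 W0 W1 W2 W3.
move=> /laurent_mulP[c2 w2] /laurent_mulP[c2' w2'].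
move=> /laurent_mulP[c3 w3] /laurent_mulP[c3' w3'].
move=> /IDer_inner[a w0] /IDer_inner[a' w0'].
move=> /laurent_mulP[c1 w1] /laurent_mulP[c1' w1'] E.
have : inner (a - a') + (c1 - c1') *: D11 + (c2 - c2') *: D12
    + (c3 - c3') *: D22 = 0.
  have -> : inner (a - a') = inner a - inner a'.
    apply: der_ext => u; rewrite -[RHS]/((a * u - u * a) - (a' * u - u * a')) /=.
    by rewrite mulrBl mulrBr !opprD addrACA.
  rewrite !scalerBl -w0 -w0' -w1 -w1' -w2 -w2' -w3 -w3'.
  rewrite [X in X + _ + _]addrACA -opprD [X in X + _]addrACA -opprD.
  by rewrite addrACA -opprD E subrr.
move=> /der_decomposition_uniq[].
move=> /eqP; rewrite subr_eq0 => /eqP e1 /eqP; rewrite subr_eq0 => /eqP e2.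
move=> /eqP; rewrite subr_eq0 => /eqP e3; move: E.
(* The inner components are compared by cancellation, since [a] and [a'] are determined only up to a
   central element. *)
rewrite w1 w1' w2 w2' w3 w3' e1 e2 e3 => /addIr/addIr/addIr e0.
by apply: I4; rewrite ?w1 ?w1' ?w2 ?w2' ?w3 ?w3' ?e1 ?e2 ?e3.
Qed.

(** The classes of [D11], [D12] and [D22] form a basis: the decomposition gives surjectivity of
    [comb] modulo inner derivations, its uniqueness injectivity. *)
Lemma HH1_free : free_of_rank 3 (HH1 U).
Proof.
pose comb (v : 'rV[center U]_3) : Der U :=
  v 0 i11 *: D11 + v 0 i12 *: D12 + v 0 i22 *: D22.
have combP k r t : comb (k *: r + t) = k *: comb r + comb t.
  rewrite /comb !mxE !scalerDl !scalerDr !scalerA [RHS]addrACA.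
  by rewrite [X in _ = X + _]addrACA.
have flin : linear (fun r => HH1_pi (comb r)).
  by move=> k r t; rewrite combP HH1_piD HH1_piZ.
pose L := GRing.isLinear.Build (center U) 'rV[center U]_3 (HH1 U) _ _ flin.
pose f : {linear 'rV[center U]_3 -> HH1 U} := HB.pack (fun r => HH1_pi (comb r)) L.
have f_inj : injective f.
  move=> r t /HH1_piP/IDer_inner[a].
  have -> : comb r - comb t = comb (r - t).
    by rewrite -scaleN1r addrC -combP scaleN1r addrC.
  move=> E; have E0 : inner (- a) + comb (r - t) = 0.
    rewrite E; apply: der_ext => w.
    rewrite -[LHS]/((- a * w - w * - a) + (a * w - w * a)).
    by rewrite mulNr mulrN opprK addrACA addNr subrr addr0.
  move: E0; rewrite /comb !addrA => /der_decomposition_uniq[c1 c2 c3].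
  apply/rowP => i; apply/eqP; rewrite -subr_eq0.
  by have := c1; have := c2; have := c3; rewrite !mxE;
    have [->|[->|->]] := gen_case i => *; apply/eqP.
have f_surj w : exists r, f r = w.
  have [D <-] : exists D, HH1_pi D = w by eexists; exact: HH1_reprK.
  have [a [c1 [c2 [c3 ->]]]] := der_decomposition D.
  exists (\row_i tnth [tuple c1; c2; c3] i).
  apply/esym/HH1_piP; rewrite /comb !mxE !(tnth_nth 0) !inordK //=.
  by rewrite -2![inner a + _ + _]addrA addrK inner_IDer.
exists f; exists (fun w => sval (cid (f_surj w))) => [r|w]; last by case: cid.
by apply: f_inj; case: cid.
Qed.

End QuantumBasisTheory.

(** * Transfer to the generators of UT_q(2) *)

Theorem theorem5p4 (K : fieldType) (charK : 2%N \notin [pchar K])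
    (q : K) (q_neq0 : q != 0)
    (q_nroot : forall n : nat, (0 < n)%N -> q ^+ n != 1)
    (T : algType K) (a11 a12 a22 : T) (presT : is_Tq2 q a11 a12 a22)
    (U : unitAlgType K) (iota : {lrmorphism T -> U})
    (locU : is_UTq2 a11 a22 iota) :
  let z : U := iota a11 * (iota a22)^-1 in
  exists D11 D12 D22 : Der U,
    [/\ unique (fun D : Der U => [/\ D (iota a11) = iota a11,
                                     D (iota a12) = 0
                                   & D (iota a22) = 0]) D11,
        unique (fun D : Der U => [/\ D (iota a11) = 0,
                                     D (iota a12) = iota a12
                                   & D (iota a22) = 0]) D12
      & unique (fun D : Der U => [/\ D (iota a11) = 0,
                                     D (iota a12) = 0
                                   & D (iota a22) = iota a22]) D22] /\
    [/\ internal_direct_sum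
          (tnth [tuple [set D | D \in @IDer K U]; laurent_mul z D11;
                       laurent_mul z D12; laurent_mul z D22]),
        laurent_free z,
        [set u | u \in @central U] = laurent z
      & free_of_rank 3 (HH1 U)].
Proof.
move=> z; have basis := localization_quantum_basis q_neq0 presT locU.
have xU := qb_unitx basis; have zU := qb_unitz basis.
have wU : iota a22 \is a GRing.unit.
  by have [SU _ _] := locU; apply: SU; apply: sub_gen_smallest; right.
have zw : z * iota a22 = iota a11 by rewrite divrK.
exists (euler q_neq0 basis 0 1 1), (euler q_neq0 basis 1 0 0),
  (euler q_neq0 basis 0 0 (-1)); split; last first.
  split.
  - exact: (der_direct_sum q_neq0 q_nroot basis).
  - exact: (z_laurent_free basis).
  - by apply/seteqP; split=> u /= uC;
      apply/(central_laurent q_neq0 q_nroot basis).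
  - exact: (HH1_free q_neq0 q_nroot basis).
(* From z a22 = a11, the weight of a22 is that of a11 minus that of z. *)
have eulerw cy cx cz : euler q_neq0 basis cy cx cz (iota a22) =
    (cx - cz) *: iota a22.
  apply: (mulrI zU); rewrite -scalerAr zw scalerBl.
  have := derM (euler q_neq0 basis cy cx cz) z (iota a22).
  rewrite zw euler_x euler_z -scalerAl zw => ->.
  by rewrite addrAC subrr add0r.
(* The Leibniz rule for z a22 = a11 determines D z from the values on a11 and a22, as a22 is a
   unit. *)
have der_w (D E : Der U) : D (iota a11) = E (iota a11) ->
    D (iota a12) = E (iota a12) -> D (iota a22) = E (iota a22) -> D = E.
  move=> Dx Dy Dw; apply: (der_eq basis) => //; apply: (mulIr wU).
  by apply: (addIr (z * D (iota a22))); rewrite -derM Dw -derM zw.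
split; split; rewrite ?euler_x ?euler_y ?eulerw ?subrr ?subr0 ?sub0r ?opprK
  ?scale0r ?scale1r // => D [Dx Dy Dw]; apply: der_w;
  by rewrite ?euler_x ?euler_y ?eulerw ?subrr ?subr0 ?sub0r ?opprK
    ?scale0r ?scale1r ?Dx ?Dy ?Dw.
Qed.
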